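(* Let $D_{L-1}, D_L \in \mathbb{N}$, let $G_L : \mathbb{R}^{D_{L-1}} \to \mathbb{R}^{D_L}$ be a linear map, and let $o \in \mathbb{R}^{D_L}$, $\bar z \in \mathbb{R}^{D_{L-1}}$ and $\lambda > 0$. Put $o' := o - G_L(\bar z)$. Then the convex optimization problem $$\min_{z \in \mathbb{R}^{D_{L-1}}} \; \Vert G_L(z) - o \Vert_2^2 + \lambda \Vert z - \bar z \Vert_1 \qquad (\mathrm{P})$$ is equivalent to the lasso problem $$\min_{z \in \mathbb{R}^{D_{L-1}}} \; \Vert G_L(z) - o' \Vert_2^2 + \lambda \Vert z \Vert_1 , \qquad (\mathrm{P}')$$ in the following sense: the two problems have the same minimal value, and $\hat z'$ is a minimizer of $(\mathrm{P}')$ if and only if $\hat z := \hat z' + \bar z$ is a minimizer of $(\mathrm{P})$.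
   Context: $\Vert\cdot\Vert_2$ and $\Vert\cdot\Vert_1$ denote the Euclidean norm and the $\ell_1$-norm. *)

(* Defs.v *)
From mathcomp Require Import all_boot all_order all_algebra.
From mathcomp Require Import reals.

Set Implicit Arguments.
Unset Strict Implicit.
Unset Printing Implicit Defensive.

Import Order.TTheory GRing.Theory Num.Theory.
Local Open Scope ring_scope.

(* Vectors of R^n are row vectors. The norms are defined here because the
   library norm `|x| on 'rV[R]_n is the sup norm. *)
Definition norm2 (R : realType) (n : nat) (x : 'rV[R]_n) : R :=
  Num.sqrt (\sum_(i < n) x ord0 i ^+ 2).

Definition norm1 (R : realType) (n : nat) (x : 'rV[R]_n) : R :=
  \sum_(i < n) `|x ord0 i|.

Definition is_minimizer (R : realType) (T : Type) (f : T -> R) (x : T) : Prop :=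
  forall y : T, f x <= f y.

(* An attained minimum, not merely an infimum. *)
Definition is_min_value (R : realType) (T : Type) (f : T -> R) (v : R) : Prop :=
  (exists x : T, f x = v) /\ (forall y : T, v <= f y).

(* Main.v *)
Require Import Defs.
From mathcomp Require Import all_boot all_order all_algebra.
From mathcomp Require Import reals.
From mathcomp Require Import boolp classical_sets topology.
From mathcomp Require Import normedtype derive.

Set Implicit Arguments.
Unset Strict Implicit.
Unset Printing Implicit Defensive.

Import Order.TTheory GRing.Theory Num.Theory.
Import numFieldNormedType.Exports.
Local Open Scope ring_scope.

(** The translation [z' |-> z' + zbar] carries the objective of (P') to that of
(P), so minimizers and values correspond. The minimum is attained because
the objective of (P') is continuous and any point with a coordinate larger than
[P' 0 / lambda] in absolute value is worse than 0: it suffices to minimize over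
a compact box. *)

Lemma norm1_0 (R : realType) (n : nat) : norm1 (0 : 'rV[R]_n) = 0.
Proof. by rewrite /norm1 big1 // => i _; rewrite mxE normr0. Qed.

Lemma ler_coord_norm1 (R : realType) (n : nat) (x : 'rV[R]_n) (i : 'I_n) :
  `|x ord0 i| <= norm1 x.
Proof. by rewrite /norm1 (bigD1 i) //= lerDl sumr_ge0. Qed.

Lemma sqr_norm2 (R : realType) (n : nat) (x : 'rV[R]_n) :
  norm2 x ^+ 2 = \sum_(i < n) x ord0 i ^+ 2.
Proof. by rewrite sqr_sqrtr // sumr_ge0 // => i _; rewrite sqr_ge0. Qed.

Lemma continuous_sum (R : realType) (T : topologicalType) (n : nat)
    (f : 'I_n -> T -> R) :
  (forall i, continuous (f i)) -> continuous (fun x => \sum_(i < n) f i x).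
Proof.
by move=> cf; apply: continuous_big => // x; exact: add_continuous.
Qed.

Lemma continuous_norm1 (R : realType) (n : nat) :
  continuous (@norm1 R n).
Proof.
apply: continuous_sum => i x.
apply: (continuous_comp (@coord_continuous R _ _ _ _ x)).
exact: norm_continuous.
Qed.

(** In finite dimension [G] is multiplication by a matrix, so each coordinate of [G z] is a finite
    sum of coordinates of [z] times constants. *)
Lemma continuous_linear_coord (R : realType) (m n : nat)
    (G : {linear 'rV[R]_m -> 'rV[R]_n}) (i : 'I_n) :
  continuous (fun z => G z ord0 i).
Proof.
under eq_fun do rewrite -mul_rV_lin1 mxE.
apply: continuous_sum => j x.
have c : {for x, continuous (fun z : 'rV[R]_m => z ord0 j)}.
  exact: coord_continuous.
exact: (cvgMr_tmp c).
Qed.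

Lemma continuous_sqr_residual (R : realType) (m n : nat)
    (G : {linear 'rV[R]_m -> 'rV[R]_n}) (o : 'rV[R]_n) :
  continuous (fun z => norm2 (G z - o) ^+ 2).
Proof.
under eq_fun do rewrite sqr_norm2.
apply: continuous_sum => i x.
under eq_fun do rewrite mxE [X in _ + X]mxE expr2.
have c : {for x, continuous (fun z => G z ord0 i - o ord0 i)}.
  exact: (cvgB (@continuous_linear_coord R m n G i x) (cvg_cst _)).
exact: (cvgM c c).
Qed.

(** The sublevel set of [f] at level [f 0] lies in the compact box [K], so a minimizer over [K] is
    global. *)
Lemma exists_minimizer_box (R : realType) (n : nat) (f : 'rV[R]_n -> R)
    (M : R) : continuous f ->
  (forall x, f x <= f 0 -> forall i, `|x ord0 i| <= M) ->
  exists x, is_minimizer f x.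
Proof.
move=> cf fM.
pose K := [set x : 'rV[R]_n | forall i, `[(- M), M]%classic (x ord0 i)]%classic.
(* The bound [fM] at the point 0 itself shows that the box is nonempty. *)
have K0 : K 0.
  by move=> i; rewrite /= in_itv /= -ler_norml; exact: fM.
have cK : compact K.
  apply: (@rV_compact _ _ (fun=> `[(- M), M]%classic)) => _.
  exact: segment_compact.
have [||x _ xmin] := @compact_EVT_min _ R f K _ cK.
- by exists 0.
- exact: continuous_subspaceT.
have x0 : f x <= f 0 by apply: xmin; rewrite inE.
(* A point [y] with [f 0 < f y] may lie outside [K], but it loses to 0, hence to [x]. *)
exists x => y; have [y0|/ltW y0] := leP (f y) (f 0); last exact: le_trans y0.
by apply: xmin; rewrite inE => i; rewrite /= in_itv /= -ler_norml; exact: fM.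
Qed.

Lemma lasso_exists_minimizer (R : realType) (m n : nat)
    (G : {linear 'rV[R]_m -> 'rV[R]_n}) (o : 'rV[R]_n) (lambda : R) :
  0 < lambda ->
  exists z, is_minimizer (fun z => norm2 (G z - o) ^+ 2 + lambda * norm1 z) z.
Proof.
move=> l0; apply: (@exists_minimizer_box _ _ _ (norm2 (G 0 - o) ^+ 2 / lambda)).
  move=> z; apply: (cvgD (@continuous_sqr_residual R m n G o z)).
  exact: (cvgMl_tmp (@continuous_norm1 R m z)).
move=> z; rewrite norm1_0 mulr0 addr0 => zle i.
apply: le_trans (ler_coord_norm1 z i) _.
(* Dropping the squared residual at [z] bounds [lambda * norm1 z] by the objective at 0. *)
by rewrite ler_pdivlMr // mulrC; apply: le_trans zle; rewrite lerDr sqr_ge0.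
Qed.

Theorem mainTheorem1 (R : realType) (m n : nat)
    (G : {linear 'rV[R]_m -> 'rV[R]_n}) (o : 'rV[R]_n) (zbar : 'rV[R]_m)
    (lambda : R) (lambda_gt0 : 0 < lambda) :
  let o' : 'rV[R]_n := o - G zbar in
  let P (z : 'rV[R]_m) : R :=
    norm2 (G z - o) ^+ 2 + lambda * norm1 (z - zbar) in
  let P' (z : 'rV[R]_m) : R :=
    norm2 (G z - o') ^+ 2 + lambda * norm1 z in
  (exists v : R, is_min_value P v /\ is_min_value P' v) /\
  (forall z' : 'rV[R]_m, is_minimizer P' z' <-> is_minimizer P (z' + zbar)).
Proof.
move=> o' P P'.
(* By linearity, [G (z + zbar) - o = G z - (o - G zbar)]. *)
have PE z : P (z + zbar) = P' z.
  by rewrite /P /P' /o' addrK linearD opprB -addrA.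
have P'E z : P z = P' (z - zbar) by rewrite -PE subrK.
split.
  have [z zmin] := lasso_exists_minimizer G o' lambda_gt0.
  exists (P' z); split; split.
  - by exists (z + zbar).
  - by move=> y; rewrite P'E; exact: zmin.
  - by exists z.
  - exact: zmin.
(* Competitors are translated too: [y] for [P] becomes [y - zbar] for [P'], and [y] for [P'] becomes
   [y + zbar] for [P]. *)
move=> z; split=> zmin y.
- by rewrite PE P'E; exact: zmin.
- by rewrite -!PE; exact: zmin.
Qed.
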